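(* Let $d=2^L$ for a positive integer $L$, let $n\ge 1$, and let $X^\natural=\mathbf 1 e_1^{\mathsf T}\in\mathbb R^{d\times n}$ (the matrix whose first column is all ones and whose other entries are zero). Suppose each entry of $X^\natural$ is observed independently with probability $p\in(0,1]$, and let $\Omega\subset[d]\times[n]$ be the set of observed positions. Then, with probability at least $\frac12\left(1-(1-p)^d-dp(1-p)^{d-1}\right)$, $X^\natural$ is the unique solution of $$\min_{X\in\mathbb C^{d\times n}}\ \sum_{i=1}^d\big\|\mathcal H\big((e_i^{\mathsf T}FX)^{\mathsf T}\big)\big\|_*\quad\text{subject to}\quad \mathcal P_\Omega(X)=\mathcal P_\Omega(X^\natural).$$ In particular this probability bound tends to $1/2$ as $d\to\infty$ (for fixed $p$).
   Context: $n_1,n_2$ are positive integers with $n_1+n_2=n+1$. For $x=(x_1,\dots,x_n)\in\mathbb C^n$, $\mathcal H(x)\in\mathbb C^{n_1\times n_2}$ is the Hankel matrix with $[\mathcal H(x)]_{j,k}=x_{j+k-1}$. $F\in\mathbb C^{d\times d}$ is the unitary DFT matrix, $F_{jk}=d^{-1/2}e^{-2\pi \mathrm{i}(j-1)(k-1)/d}$; $e_i$ is the $i$-th standard basis vector, so $e_i^{\mathsf T}FX$ is the $i$-th row of $FX$. $\|\cdot\|_*$ is the nuclear norm (sum of singular values). $\mathcal P_\Omega:\mathbb C^{d\times n}\to\mathbb C^{d\times n}$ keeps the entries indexed by $\Omega$ and sets all other entries to zero. *)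

(* Defs.v *)
From HB Require Import structures.
From mathcomp Require Import all_boot all_order all_algebra.
From Stdlib Require Import ClassicalEpsilon.
Set Implicit Arguments. Unset Strict Implicit. Unset Printing Implicit Defensive.
Import Order.TTheory GRing.Theory Num.Theory.
Local Open Scope ring_scope.

Section Defs.
Variable C : numClosedFieldType.

Definition ctrmx m n (A : 'M[C]_(m, n)) : 'M[C]_(n, m) := (map_mx Num.conj A)^T.

Definition eigvals n (A : 'M[C]_n) : seq C :=
  sval (closed_field_poly_normal (char_poly A)).

(* singular values of A : 'M_(m,n): square roots of the eigenvalues of A^H A
   (n of them; the nonzero ones are the usual singular values) *)
Definition singvals m n (A : 'M[C]_(m, n)) : seq C :=
  [seq sqrtC z | z <- eigvals (ctrmx A *m A)].

Definition nucnorm m n (A : 'M[C]_(m, n)) : C := \sum_(s <- singvals A) s.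

Definition rv_at n (x : 'rV[C]_n) (i : nat) : C :=
  if insub i is Some l then x 0 l else 0.

(* Hankel matrix: [H(x)]_{j,k} = x_{j+k-1} (1-indexed) = x_(j+k) (0-indexed).
   When n1 + n2 = n + 1 all indices are in range. *)
Definition hankel n1 n2 n (x : 'rV[C]_n) : 'M[C]_(n1, n2) :=
  \matrix_(j < n1, k < n2) rv_at x (j + k).

(* unitary DFT matrix, F_{jk} = d^{-1/2} exp(-2 pi i (j-1)(k-1)/d);
   exp(-2 pi i / d) = conj (exp(i pi/(d/2))) = conj ((d./2).-root (-1)) for d even *)
Definition omega (d : nat) : C := Num.conj ((d./2).-root (-1)).
Definition dft (d : nat) : 'M[C]_d :=
  \matrix_(j < d, k < d) ((sqrtC (d%:R : C))^-1 * omega d ^+ (j * k)).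

Definition objective (d n n1 n2 : nat) (X : 'M[C]_(d, n)) : C :=
  \sum_(i < d) nucnorm (hankel n1 n2 (row i (dft d *m X))).

Definition Xnat (d n : nat) : 'M[C]_(d, n) :=
  \matrix_(i < d, j < n) (if val j == 0%N then 1 else 0).

Definition agree_on d n (Om : {set 'I_d * 'I_n}) (X Y : 'M[C]_(d, n)) : Prop :=
  forall i j, (i, j) \in Om -> X i j = Y i j.

Definition unique_solution d n n1 n2 (Om : {set 'I_d * 'I_n}) : Prop :=
  forall X : 'M[C]_(d, n), agree_on Om X (Xnat d n) -> X != Xnat d n ->
    objective n1 n2 (Xnat d n) < objective n1 n2 X.

Definition pbool (P : Prop) : bool :=
  if excluded_middle_informative P then true else false.

Definition prob_obs d n (p : C) (E : {set 'I_d * 'I_n} -> Prop) : C :=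
  \sum_(Om : {set 'I_d * 'I_n} | pbool (E Om))
     p ^+ #|Om| * (1 - p) ^+ (d * n - #|Om|).

Definition bound (d : nat) (p : C) : C :=
  2^-1 * (1 - (1 - p) ^+ d - d%:R * p * (1 - p) ^+ d.-1).

End Defs.

(* Main.v *)
Require Import Defs.
From HB Require Import structures.
From mathcomp Require Import all_boot all_order all_algebra.
From mathcomp Require Import zify ring.
Import Order.TTheory GRing.Theory Num.Theory.
Local Open Scope ring_scope.

(** The nuclear norm dominates the Frobenius norm, hence every entry, with
    equality at an entry only if all the others vanish.  As the first entry of
    the Hankel matrix of [y] is [y_1], the objective dominates the l1 norm of
    the Fourier transform of the first column of [X].  If that column is
    sampled at two indices [a], [b] of different parity, the mean of its two
    samples is a dual certificate: its Fourier multiplier is 1 at frequency 0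
    and, as [a - b] is a unit modulo [2 ^ L], has modulus < 1 at every other
    frequency.  With [q = 1 - p] and [m = d / 2], both parities are sampled
    with probability [(1 - q ^ m) ^ 2], and comparing this with the claimed
    bound reduces, after dividing by [p] and pairing the terms [i] and
    [m - 1 - i] of the geometric sum, to a polynomial inequality on [0, 1]^3. *)

(** * Singular values: nuclear norm against Frobenius norm and single entries *)

Section NuclearNorm.
Set Implicit Arguments.
Unset Strict Implicit.
Variable C : numClosedFieldType.

Lemma mulmx_ctrmx_diag m n (A : 'M[C]_(m, n)) i :
  (A *m ctrmx A) i i = \sum_j `|A i j| ^+ 2.
Proof. by rewrite mxE; apply: eq_bigr => j _; rewrite !mxE normCK. Qed.

Lemma ctrmx_mulmx_diag m n (A : 'M[C]_(m, n)) k :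
  (ctrmx A *m A) k k = \sum_j `|A j k| ^+ 2.
Proof. by rewrite mxE; apply: eq_bigr => j _; rewrite !mxE normCK mulrC. Qed.

Lemma eigvals_char_poly n (A : 'M[C]_n) :
  char_poly A = \prod_(z <- eigvals A) ('X - z%:P).
Proof.
rewrite /eigvals; case: closed_field_poly_normal => r /= def_p.
by rewrite {1}def_p (monicP (char_poly_monic A)) scale1r.
Qed.

Lemma size_eigvals n (A : 'M[C]_n) : size (eigvals A) = n.
Proof.
have := size_char_poly A; rewrite eigvals_char_poly size_prod_XsubC.
by case.
Qed.

Lemma sum_eigvals n (A : 'M[C]_n) : (0 < n)%N -> \sum_(z <- eigvals A) z = \tr A.
Proof.
move=> n_gt0; apply: oppr_inj; rewrite -char_poly_trace // eigvals_char_poly.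
by rewrite -{3}(size_eigvals A) coefPn_prod_XsubC // size_eigvals -lt0n.
Qed.

(** A row eigenvector v of the Gram matrix satisfies z |v|^2 = |v A^H|^2, and |v|^2 > 0. *)
Lemma eigvals_gram_ge0 m n (A : 'M[C]_(m, n)) z :
  z \in eigvals (ctrmx A *m A) -> 0 <= z.
Proof.
rewrite -root_prod_XsubC -eigvals_char_poly -eigenvalue_root_char.
case/eigenvalueP => v vAA /rV0Pn[j vj].
have v_gt0 : 0 < \sum_j `|v 0 j| ^+ 2.
  rewrite (bigD1 j) //= ltr_pwDl ?exprn_gt0 ?normr_gt0 //.
  by apply: sumr_ge0 => i _; rewrite exprn_ge0.
have ctrmx_vA : ctrmx (v *m ctrmx A) = A *m ctrmx v.
  rewrite /ctrmx map_mxM trmx_mul; congr (_ *m _).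
  by apply/matrixP => i k; rewrite !mxE /= conjCK.
have := mulmx_ctrmx_diag (v *m ctrmx A) 0.
rewrite ctrmx_vA mulmxA -(mulmxA v) vAA -scalemxAl mxE mulmx_ctrmx_diag => def_z.
by rewrite -(pmulr_lge0 _ v_gt0) def_z sumr_ge0 // => i _; rewrite exprn_ge0.
Qed.

(** The cross terms in the expanded square are nonnegative. *)
Lemma sum_le_sqr_sum_sqrtC (s : seq C) : {in s, forall z, 0 <= z} ->
  \sum_(z <- s) z <= (\sum_(z <- s) sqrtC z) ^+ 2.
Proof.
elim: s => [|z s IHs] s_ge0; first by rewrite !big_nil expr0n.
have z_ge0 : 0 <= z by rewrite s_ge0 ?mem_head.
have {}s_ge0 : {in s, forall z, 0 <= z} by move=> x xs; rewrite s_ge0 ?inE ?xs ?orbT.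
have sum_ge0 : 0 <= \sum_(x <- s) sqrtC x.
  by rewrite big_seq sumr_ge0 // => x /s_ge0; rewrite sqrtC_ge0.
rewrite !big_cons sqrrD sqrtCK -addrA lerD2l (le_trans (IHs s_ge0)) //.
by rewrite lerDr mulrn_wge0 // mulr_ge0 ?sqrtC_ge0.
Qed.

Lemma nucnorm_ge0 m n (A : 'M[C]_(m, n)) : 0 <= nucnorm A.
Proof.
rewrite /nucnorm /singvals big_map big_seq sumr_ge0 // => z.
by move/eigvals_gram_ge0; rewrite sqrtC_ge0.
Qed.

(** The trace of the Gram matrix is both the sum of the squared moduli of the entries and the sum of
    the squared singular values. *)
Lemma frobenius_le_nucnorm m n (A : 'M[C]_(m, n)) : (0 < n)%N ->
  \sum_k \sum_j `|A j k| ^+ 2 <= nucnorm A ^+ 2.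
Proof.
move=> n_gt0; rewrite /nucnorm /singvals big_map.
apply: le_trans (sum_le_sqr_sum_sqrtC (@eigvals_gram_ge0 _ _ A)).
rewrite sum_eigvals // /mxtrace.
by under [leRHS]eq_bigr do rewrite ctrmx_mulmx_diag.
Qed.


Lemma norm_entry_le_nucnorm m n (A : 'M[C]_(m, n)) j k : `|A j k| <= nucnorm A.
Proof.
rewrite -(ler_pXn2r (n := 2)) ?nnegrE ?nucnorm_ge0 //.
have n_gt0 : (0 < n)%N by apply: leq_trans (ltn_ord k).
have /(le_trans _) := frobenius_le_nucnorm A n_gt0; apply.
rewrite (bigD1 k) //= (bigD1 j) //= -addrA lerDl addr_ge0 //.
  by apply: sumr_ge0 => i _; rewrite exprn_ge0.
by do 2!(apply: sumr_ge0 => ? _); rewrite exprn_ge0.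
Qed.

(** At equality the entry (j, k) exhausts the Frobenius bound, so the squared modulus of any other
    entry is at most 0. *)
Lemma norm_entry_eq_nucnorm m n (A : 'M[C]_(m, n)) j k j' k' :
  `|A j k| = nucnorm A -> (j', k') != (j, k) -> A j' k' = 0.
Proof.
move=> eqA neq_jk.
have n_gt0 : (0 < n)%N by apply: leq_trans (ltn_ord k).
have := frobenius_le_nucnorm A n_gt0; rewrite -eqA exchange_big pair_bigA /=.
rewrite (bigD1 (j, k)) //= (bigD1 (j', k')) //= -{2}[_ ^+ 2]addr0 lerD2l => le0.
apply/eqP; rewrite -normr_eq0 -sqrf_eq0 eq_le exprn_ge0 // andbT.
apply: le_trans le0; rewrite lerDl sumr_ge0 // => ? _; exact: exprn_ge0.
Qed.

(** The Gram matrix is then diagonal, its only possibly nonzero entry being |A j k|^2 at (k, k), so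
    its eigenvalues can be read off. *)
Lemma nucnorm_single m n (A : 'M[C]_(m, n)) j k :
  (forall j' k', (j', k') != (j, k) -> A j' k' = 0) -> nucnorm A = `|A j k|.
Proof.
move=> A0.
have gram_offdiag i i' : i != i' -> (ctrmx A *m A) i i' = 0.
  move=> neq_i; rewrite mxE big1 // => l _; rewrite !mxE.
  have [eq_i|neq_ik] := eqVneq i k.
    by rewrite [A l i']A0 ?mulr0 // xpair_eqE -eq_i [i' == i]eq_sym (negPf neq_i) andbF.
  by rewrite [A l i]A0 ?conjC0 ?mul0r // xpair_eqE (negPf neq_ik) andbF.
have gram_diag i : (ctrmx A *m A) i i = (`|A j k| *+ (i == k)) ^+ 2.
  rewrite ctrmx_mulmx_diag (bigD1 j) //= big1 ?addr0 => [|l neq_lj]; last first.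
    by rewrite A0 ?normr0 ?expr0n // xpair_eqE (negPf neq_lj).
  have [->|neq_ik] := eqVneq i k; first by rewrite mulr1n.
  by rewrite A0 ?normr0 ?mulr0n // xpair_eqE (negPf neq_ik) andbF.
have gram_trig : is_trig_mx (ctrmx A *m A).
  by apply/is_trig_mxP => i i' lt_i; rewrite gram_offdiag // -val_eqE /= ltn_eqF.
(* [eigvals] is a chosen list of roots, determined by the characteristic polynomial only up to
   order. *)
have perm_eig :
    perm_eq (eigvals (ctrmx A *m A)) [seq (ctrmx A *m A) i i | i <- enum 'I_n].
  apply: prod_XsubC_eq; rewrite -eigvals_char_poly char_poly_trig // big_map.
  by rewrite big_enum.
rewrite /nucnorm /singvals big_map (perm_big _ perm_eig) big_map big_enum /=.
rewrite (bigD1 k) //= big1 ?addr0 => [|i /negPf neq_ik].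
  by rewrite gram_diag eqxx mulr1n sqrCK.
by rewrite gram_diag neq_ik mulr0n expr0n sqrtC0.
Qed.

End NuclearNorm.

(** * The discrete Fourier transform and roots of unity *)

Section DiscreteFourier.
Set Implicit Arguments.
Unset Strict Implicit.
Variable C : numClosedFieldType.

(** The order divides 2^L, hence is a power of 2; a smaller one would divide 2^(L-1), whereas
    [omega] to the power 2^(L-1) is -1. *)
Lemma omega_prim L : (0 < L)%N -> (2 ^ L).-primitive_root (omega C (2 ^ L)).
Proof.
case: L => // L _.
have half : ((2 ^ L.+1)./2 = 2 ^ L)%N by rewrite expnS mul2n doubleK.
have omegaX : omega C (2 ^ L.+1) ^+ (2 ^ L) = -1.
  by rewrite /omega half -rmorphXn rootCK ?expn_gt0 // rmorphN1.
have omega1 : omega C (2 ^ L.+1) ^+ (2 ^ L.+1) = 1.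
  by rewrite {2}expnSr exprM omegaX sqrrN expr1n.
have [m prim_m /(dvdn_pfactor _ _ (isT : prime 2))[e le_eL def_m]] :=
  prim_order_exists (expn_gt0 2 L.+1 : (0 < 2 ^ L.+1)%N) omega1.
move: le_eL prim_m; rewrite {m}def_m leq_eqVlt => /predU1P[-> // | lt_eL] prim_e.
have /eqP := omegaX; rewrite -subr_eq0 -{2}(subnKC (ltnSE lt_eL)) expnD exprM.
by rewrite (prim_expr_order prim_e) expr1n opprK -mulr2n pnatr_eq0.
Qed.

Lemma sum_expr_unity_root (R : idomainType) d (z : R) :
  z ^+ d = 1 -> \sum_(k < d) z ^+ k = d%:R *+ (z == 1).
Proof.
move=> zd1; have [->|neq_z1] := eqVneq z 1.
  by under eq_bigr do rewrite expr1n; rewrite sumr_const card_ord mulr1n.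
have /eqP := subrX1 z d; rewrite zd1 subrr eq_sym mulf_eq0 subr_eq0 (negPf neq_z1).
by move/eqP => ->.
Qed.

Lemma normr_omega d : d.-primitive_root (omega C d) -> `|omega C d| = 1.
Proof.
move=> prim_w; apply/eqP.
by rewrite -(pexpr_eq1 (prim_order_gt0 prim_w)) // -normrX (prim_expr_order prim_w) normr1.
Qed.

(** The conjugate transpose of [dft] when [omega] has modulus 1: conjugates of its powers are
    written as inverses, which keeps the computations algebraic. *)
Definition idft d : 'M[C]_d :=
  \matrix_(j < d, k < d) ((sqrtC (d%:R : C))^-1 * omega C d ^- (j * k)).

Lemma idftK d : d.-primitive_root (omega C d) -> idft d *m dft C d = 1%:M.
Proof.
move=> prim_w; have d_gt0 := prim_order_gt0 prim_w.
have w_neq0 : omega C d != 0 by rewrite -normr_eq0 normr_omega // oner_eq0.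
apply/matrixP => j l; rewrite !mxE.
set z := omega C d ^+ l / omega C d ^+ j.
have -> : \sum_k idft d j k * dft C d k l = (d%:R)^-1 * \sum_(k < d) z ^+ k.
  rewrite mulr_sumr; apply: eq_bigr => k _; rewrite !mxE mulrACA -expr2 exprVn sqrtCK.
  by congr (_ * _); rewrite expr_div_n -!exprM (mulnC k) mulrC.
rewrite sum_expr_unity_root; last first.
  by rewrite expr_div_n -!exprM ![(_ * d)%N]mulnC !exprM (prim_expr_order prim_w) !expr1n divr1.
rewrite /z -(inj_eq (mulIf (expf_neq0 j w_neq0))) mul1r divfK ?expf_neq0 //.
rewrite (eq_prim_root_expr prim_w) !modn_small // eq_sym val_eqE.
case: eqP => _; last by rewrite mulr0n mulr0.
by rewrite !mulr1n mulVf // pnatr_eq0 -lt0n.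
Qed.

(** A constant column has only frequency 0, where d terms equal to d^(-1/2) add up to the square
    root of d. *)
Lemma dft_col_one d n (i0 : 'I_d) i (j : 'I_n) :
  d.-primitive_root (omega C d) -> i0 = 0%N :> nat ->
  (dft C d *m Xnat C d n) i j = sqrtC d%:R *+ ((i == i0) && (j == 0%N :> nat)).
Proof.
move=> prim_w i0_0; have d_gt0 := prim_order_gt0 prim_w; rewrite mxE.
under eq_bigr do rewrite !mxE.
case: (eqVneq (val j) 0%N) => [_|_]; last by rewrite andbF mulr0n big1 // => k _; rewrite mulr0.
under eq_bigr do rewrite mulr1 exprM.
rewrite -mulr_sumr sum_expr_unity_root; last first.
  by rewrite -exprM mulnC exprM (prim_expr_order prim_w) expr1n.
have -> : (omega C d ^+ i == 1) = (i == i0).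
  by rewrite -(prim_order_dvd prim_w) /dvdn modn_small // -val_eqE /= i0_0.
rewrite andbT; case: eqP => _; last by rewrite mulr0n mulr0.
rewrite !mulr1n -[X in _ * X]sqrtCK expr2 mulKf //.
by rewrite sqrtC_eq0 pnatr_eq0 -lt0n.
Qed.

(** By the parallelogram law, |x + y|^2 = 4 - |x - y|^2. This makes the certificate strict away from
    frequency 0. *)
Lemma norm_add_lt (x y : C) : `|x| = 1 -> `|y| = 1 -> x != y -> `|x + y| < 2.
Proof.
move=> x1 y1 neq_xy; rewrite -(ltr_pXn2r (n := 2)) ?nnegrE //.
have -> : 2 ^+ 2 = `|x + y| ^+ 2 + `|x - y| ^+ 2 :> C.
  have -> : `|x + y| ^+ 2 + `|x - y| ^+ 2 = 2 * (`|x| ^+ 2 + `|y| ^+ 2).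
    by rewrite !normCK rmorphD rmorphB; ring.
  by rewrite x1 y1; ring.
by rewrite ltrDl exprn_gt0 // normr_gt0 subr_eq0.
Qed.

End DiscreteFourier.

(** * Exact recovery from two samples of opposite parity in the first column *)

Section Recovery.
Set Implicit Arguments.
Unset Strict Implicit.
Variable C : numClosedFieldType.

Lemma rv_at_ord n (x : 'rV[C]_n) (l : 'I_n) k : l = k :> nat -> rv_at x k = x 0 l.
Proof. by move=> <-; rewrite /rv_at valK. Qed.

(** The first column and the last row of the Hankel matrix together run through all coordinates. *)
Lemma antidiagonal_ex n n1 n2 (l : 'I_n) : (0 < n1)%N -> (0 < n2)%N ->
  (n1 + n2 = n + 1)%N -> exists (j : 'I_n1) (k : 'I_n2), l = (j + k)%N :> nat.
Proof.
move=> n1_gt0 n2_gt0 def_n; have lt_ln := ltn_ord l.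
have [lt_l|ge_l] := ltnP l n1.
  by exists (Ordinal lt_l), (Ordinal n2_gt0); rewrite /= addn0.
have lt_j : (n1.-1 < n1)%N by lia.
have lt_k : (l - n1.-1 < n2)%N by lia.
by exists (Ordinal lt_j), (Ordinal lt_k) => /=; lia.
Qed.

Lemma nucnorm_hankel_ge n n1 n2 (x : 'rV[C]_n) (l0 : 'I_n) :
  (0 < n1)%N -> (0 < n2)%N -> l0 = 0%N :> nat ->
  `|x 0 l0| <= nucnorm (hankel n1 n2 x).
Proof.
move=> n1_gt0 n2_gt0 l00.
have := norm_entry_le_nucnorm (hankel n1 n2 x) (Ordinal n1_gt0) (Ordinal n2_gt0).
by rewrite mxE (rv_at_ord x (l := l0)).
Qed.

Lemma nucnorm_hankel_eq n n1 n2 (x : 'rV[C]_n) (l0 : 'I_n) :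
  (0 < n1)%N -> (0 < n2)%N -> (n1 + n2 = n + 1)%N -> l0 = 0%N :> nat ->
  `|x 0 l0| = nucnorm (hankel n1 n2 x) <-> (forall l, l != l0 -> x 0 l = 0).
Proof.
move=> n1_gt0 n2_gt0 def_n l00.
pose j0 := Ordinal n1_gt0; pose k0 := Ordinal n2_gt0.
have entry00 : hankel n1 n2 x j0 k0 = x 0 l0 by rewrite mxE (rv_at_ord x (l := l0)).
rewrite -entry00; split=> [eq_nuc l neq_l | x0].
  have [j [k def_l]] := antidiagonal_ex l n1_gt0 n2_gt0 def_n.
  have := norm_entry_eq_nucnorm (j' := j) (k' := k) eq_nuc.
  rewrite mxE (rv_at_ord x def_l); apply; apply: contra neq_l => /eqP[j_0 k_0].
  by rewrite -val_eqE /= def_l j_0 k_0 l00.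
apply/esym/nucnorm_single => j k neq_jk; rewrite mxE.
(* The largest index is (n1 - 1) + (n2 - 1) = n - 1, so each Hankel entry is a genuine coordinate of
   [x]. *)
have lt_jk : (j + k < n)%N by have := ltn_ord j; have := ltn_ord k; lia.
rewrite (rv_at_ord x (l := Ordinal lt_jk)) // x0 //.
apply: contra neq_jk => /eqP/(congr1 val)/=/eqP; rewrite l00 addn_eq0.
by rewrite xpair_eqE -!val_eqE.
Qed.

Lemma objective_Xnat d n n1 n2 : d.-primitive_root (omega C d) ->
  (0 < n)%N -> (0 < n1)%N -> (0 < n2)%N -> (n1 + n2 = n + 1)%N ->
  objective n1 n2 (Xnat C d n) = sqrtC d%:R.
Proof.
move=> prim_w n_gt0 n1_gt0 n2_gt0 def_n; have d_gt0 := prim_order_gt0 prim_w.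
pose i0 := Ordinal d_gt0; pose l0 := Ordinal n_gt0.
rewrite /objective (eq_bigr (fun i => sqrtC d%:R *+ (i == i0))) => [|i _].
  by rewrite (bigD1 i0) //= big1 ?addr0 // => i /negPf->.
have <- : `|row i (dft C d *m Xnat C d n) 0 l0| =
    nucnorm (hankel n1 n2 (row i (dft C d *m Xnat C d n))).
  apply/nucnorm_hankel_eq => // l neq_l.
  by rewrite mxE (@dft_col_one _ _ _ i0) // -[l == _ :> nat]/(l == l0) (negPf neq_l) andbF.
rewrite mxE (@dft_col_one _ _ _ i0) // eqxx andbT.
by case: eqP => _; rewrite ?mulr0n ?normr0 // mulr1n ger0_norm ?sqrtC_ge0.
Qed.

(** With r the square root of d and Y = F X, the chain is 2 r = |sum e_k Y_k| <= sum |e_k| |Y_k| <=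
    2 sum nuc_k, where Y_k is the first entry of row k and the last sum is the objective. Optimality
    makes every inequality tight, which leaves Y only one nonzero entry. *)
Lemma unique_solution_two_samples d n n1 n2 (Om : {set 'I_d * 'I_n}) (a b : 'I_d)
    (l0 : 'I_n) : d.-primitive_root (omega C d) -> (0 < n1)%N -> (0 < n2)%N ->
  (n1 + n2 = n + 1)%N -> l0 = 0%N :> nat -> (a, l0) \in Om -> (b, l0) \in Om ->
  (forall k : 'I_d, (0 < k)%N -> omega C d ^+ (a * k) != omega C d ^+ (b * k)) ->
  @unique_solution C d n n1 n2 Om.
Proof.
move=> prim_w n1_gt0 n2_gt0 def_n l00 Om_a Om_b w_ab X agreeX neqX.
have d_gt0 := prim_order_gt0 prim_w.
have n_gt0 : (0 < n)%N by apply: leq_trans (ltn_ord l0).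
rewrite objective_Xnat //.
set r := sqrtC _; have r_gt0 : 0 < r by rewrite sqrtC_gt0 ltr0n.
have w_neq0 : omega C d != 0 by rewrite -normr_eq0 normr_omega // oner_eq0.
pose Y := dft C d *m X; have defX : X = idft C d *m Y by rewrite mulmxA idftK ?mul1mx.
have norm_wV m : `|omega C d ^- m| = 1 by rewrite normfV normrX normr_omega // expr1n invr1.
(* Up to the factor r, this is the sum of rows a and b of [idft], that is, twice the multiplier of
   the certificate. *)
pose e (k : 'I_d) := omega C d ^- (a * k) + omega C d ^- (b * k).
pose nuc i := nucnorm (hankel n1 n2 (row i Y)).
have ge_nuc i : `|Y i l0| <= nuc i.
  by have := nucnorm_hankel_ge (row i Y) n1_gt0 n2_gt0 l00; rewrite mxE.
have e_le2 k : `|e k| <= 2 by rewrite (le_trans (ler_normD _ _)) // !norm_wV.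
have e_lt2 (k : 'I_d) : (0 < k)%N -> `|e k| < 2.
  by move=> k_gt0; rewrite norm_add_lt // (inj_eq invr_inj) w_ab.
have sum_e : 2 * r <= \sum_k `|e k| * `|Y k l0|.
  have <- : `|\sum_k e k * Y k l0| = 2 * r.
    have -> : \sum_k e k * Y k l0 = r * (X a l0 + X b l0).
      rewrite [in RHS]defX !mxE -big_split /= mulr_sumr.
      apply: eq_bigr => k _; rewrite !mxE -/r /e; field.
      by rewrite !expf_neq0 // gt_eqF.
    rewrite !agreeX // !mxE /= l00 /= normrM gtr0_norm // mulrC -[1 + 1]/(2%:R).
    by rewrite normr_nat.
  by rewrite (le_trans (ler_norm_sum _ _ _)) //; under eq_bigr do rewrite normrM.
have gap_ge0 i : 0 <= 2 * nuc i - `|e i| * `|Y i l0|.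
  by rewrite subr_ge0 ler_pM.
have sum_gap : \sum_i (2 * nuc i - `|e i| * `|Y i l0|) =
    2 * objective n1 n2 X - \sum_i `|e i| * `|Y i l0|.
  by rewrite sumrB -mulr_sumr.
have r_le : r <= objective n1 n2 X.
  rewrite -(ler_pM2l (x := 2)) // (le_trans sum_e) // -subr_ge0 -sum_gap.
  exact: sumr_ge0.
rewrite lt_neqAle r_le andbT; apply: contraNneq neqX => eq_r.
(* The gaps are nonnegative and, once the objective equals r, [sum_e] makes their sum at most 0. *)
have gap0 i : 2 * nuc i = `|e i| * `|Y i l0|.
  apply/eqP; rewrite -subr_eq0; apply: contraTT sum_e => gap_i.
  have gap_gt0 : 0 < \sum_i (2 * nuc i - `|e i| * `|Y i l0|).
    rewrite (bigD1 i) //= ltr_pwDl ?sumr_ge0 // lt_neqAle eq_sym gap_i.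
    exact: gap_ge0.
  by move: gap_gt0; rewrite sum_gap -eq_r subr_gt0 => /lt_geF->.
have eq_nuc i : `|Y i l0| = nuc i.
  apply/eqP; rewrite eq_le ge_nuc -(ler_pM2l (x := 2)) // gap0.
  by rewrite ler_wpM2r.
have Y_freq0 (i : 'I_d) : (0 < i)%N -> Y i l0 = 0.
  move=> i_gt0; apply/eqP; rewrite -normr_eq0.
  have := gap0 i; rewrite -eq_nuc => /eqP; rewrite -subr_eq0 -mulrBl mulf_eq0.
  by rewrite subr_eq0 gt_eqF ?e_lt2.
have Y_col0 i l : l != l0 -> Y i l = 0.
  move=> neq_l; have /(nucnorm_hankel_eq (row i Y) n1_gt0 n2_gt0 def_n l00) : 
    `|row i Y 0 l0| = nuc i by rewrite mxE.
  by move/(_ l neq_l); rewrite mxE.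
(* Only frequency 0 survives, and there all entries of [idft] agree; the sample at a then fixes the
   constant of the first column. *)
have constX i l : X i l = X a l.
  rewrite defX !mxE; apply: eq_bigr => k _.
  have [k0|k_gt0] := posnP k; first by rewrite !mxE k0 !muln0.
  have [->|neq_l] := eqVneq l l0; first by rewrite Y_freq0 // !mulr0.
  by rewrite Y_col0 // !mulr0.
apply/eqP/matrixP => i l; rewrite constX mxE.
have [->|neq_l] := eqVneq l l0; first by rewrite agreeX // mxE.
move: (neq_l); rewrite -val_eqE /= l00 => /negPf->.
by rewrite defX mxE big1 // => k _; rewrite Y_col0 // mulr0.
Qed.

Lemma unique_solution_mixed_parity L n n1 n2 (Om : {set 'I_(2 ^ L) * 'I_n})
    (a b : 'I_(2 ^ L)) (l0 : 'I_n) : (0 < L)%N -> (0 < n1)%N -> (0 < n2)%N ->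
  (n1 + n2 = n + 1)%N -> l0 = 0%N :> nat -> (a, l0) \in Om -> (b, l0) \in Om ->
  odd a != odd b -> @unique_solution C (2 ^ L) n n1 n2 Om.
Proof.
move=> L_gt0 n1_gt0 n2_gt0 def_n l00 Om_a Om_b; have prim_w := omega_prim C L_gt0.
(* Ordering a and b lets b - a be a natural number. It is odd, hence coprime to 2^L, so 2^L divides
   (b - a) k only if it divides k, which 0 < k < 2^L excludes. *)
wlog le_ab : a b Om_a Om_b / (a <= b)%N.
  by move=> IH; case: (leqP a b) => [|/ltnW] /IH ab neq_ab; apply: ab => //; rewrite eq_sym.
move=> neq_ab; apply: (@unique_solution_two_samples _ _ _ _ _ a b l0) => // k k_gt0.
rewrite eq_sym (eq_prim_root_expr prim_w) eqn_mod_dvd ?leq_mul2r ?le_ab ?orbT //.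
rewrite -mulnBl Gauss_dvdr ?gtnNdvd // coprimeXl // coprime2n oddB //.
by case: odd neq_ab; case: odd.
Qed.

End Recovery.

(** * Probability that both parity classes are sampled *)

Section Probability.
Set Implicit Arguments.
Unset Strict Implicit.

Lemma sum_subsets_avoiding (R : comNzRingType) (T : finType) (p : R) (A : {set T}) :
  \sum_(Om : {set T} | Om :&: A == set0) p ^+ #|Om| * (1 - p) ^+ (#|T| - #|Om|) =
  (1 - p) ^+ #|A|.
Proof.
(* Expanding this product over subsets kills exactly those that meet A, while the factors outside A
   equal p + (1 - p) = 1. *)
have <- : \prod_x ((if x \in A then 0 else p) + (1 - p)) = (1 - p) ^+ #|A|.
  rewrite (bigID (mem A)) /= [X in _ * X]big1 ?mulr1 => [|x /negPf->]; last by ring.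
  by rewrite (eq_bigr (fun=> 1 - p)) ?prodr_const // => x ->; rewrite add0r.
rewrite bigA_distr big_mkcond; apply: eq_bigr => Om _.
have [disj|/set0Pn[x]] := eqVneq; last first.
  by rewrite inE => /andP[Om_x A_x]; rewrite (bigD1 x) //= Om_x A_x mul0r.
have -> : (#|T| - #|Om|)%N = #|~: Om| by rewrite -(cardsC Om) addKn.
rewrite [RHS](bigID (mem Om)) /= -!prodr_const; congr (_ * _).
  apply: eq_bigr => x Om_x; rewrite Om_x; case: ifP => // A_x.
  by have := in_set0 x; rewrite -disj inE Om_x A_x.
by apply: eq_big => x; rewrite ?inE // => /negPf->.
Qed.

Lemma card_odd_ord m b : #|[set i : 'I_m.*2 | odd i == b]| = m.
Proof.
rewrite -sum1_card big_mkcond (eq_bigr (fun i : 'I_m.*2 => nat_of_bool (odd i == b))).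
  elim: m => [|m IHm]; first by rewrite big_ord0.
  by rewrite doubleS !big_ord_recr /= IHm odd_double; move: b {IHm} => [] /=; lia.
by move=> i _; rewrite inE; case: eqP.
Qed.

Lemma sum_hitting_both (R : comNzRingType) (T : finType) (p : R) (A B : {set T}) m :
    [disjoint A & B] -> #|A| = m -> #|B| = m ->
  \sum_(Om : {set T} | (Om :&: A != set0) && (Om :&: B != set0))
     p ^+ #|Om| * (1 - p) ^+ (#|T| - #|Om|) = (1 - (1 - p) ^+ m) ^+ 2.
Proof.
move=> disjAB cardA cardB; pose w (Om : {set T}) := p ^+ #|Om| * (1 - p) ^+ (#|T| - #|Om|).
have cardAB : #|A :|: B| = (m + m)%N by rewrite cardsU disjoint_setI0 // cards0 subn0 cardA cardB.
(* Inclusion-exclusion over avoiding A, B or both; the total mass 1 is written as the probability of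
   avoiding the empty set, so that all four terms are sums of one kind. *)
have -> : (1 - (1 - p) ^+ m) ^+ 2 =
    (1 - p) ^+ #|@set0 T| - (1 - p) ^+ #|A| - (1 - p) ^+ #|B| + (1 - p) ^+ #|A :|: B|.
  by rewrite cards0 cardA cardB cardAB exprD; ring.
rewrite -!sum_subsets_avoiding -/w !(big_mkcond (fun _ => _ == _)) (big_mkcond (fun _ => _ && _)).
rewrite -!sumrB -big_split /=; apply: eq_bigr => Om _.
rewrite setI0 eqxx setIUr setU_eq0.
by case: (Om :&: A == set0); case: (Om :&: B == set0); rewrite /=; ring.
Qed.

(** * Elementary inequalities for powers of q = 1 - p *)

Section Inequalities.
Variable C : numDomainType.
Implicit Types a b q : C.

Lemma paired_terms_ge0 a b q : 0 <= a <= 1 -> 0 <= b <= 1 -> 0 <= q <= 1 ->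
  0 <= (a + b) * (1 - 3 * (a * b * q)) + 4 * ((a * b) ^+ 2 * q).
Proof.
move=> /andP[a0 a1] /andP[b0 b1] /andP[q0 q1].
(* Linear in q; at q = 1, expand in the Bernstein basis in (a, b). *)
have -> : (a + b) * (1 - 3 * (a * b * q)) + 4 * ((a * b) ^+ 2 * q) =
    (1 - q) * (a + b) +
    q * (a ^+ 2 * (1 - b) ^+ 2 + 4 * (a * b * ((1 - a) * (1 - b))) +
         a * ((1 - a) * (1 - b) ^+ 2) + (1 - a) ^+ 2 * b ^+ 2 +
         (1 - a) ^+ 2 * (b * (1 - b))) by ring.
by rewrite !(subr_ge0, addr_ge0, mulr_ge0, exprn_ge0).
Qed.

(** A single term can be negative, so each is paired with its mirror image under i -> m - 1 - i. *)
Lemma geometric_sum_ge0 q m : 0 <= q <= 1 ->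
  0 <= \sum_(i < m) (q ^+ i * (1 - 3 * q ^+ m) + 2 * q ^+ (m.*2).-1).
Proof.
move=> q01; have [q0 q1] := andP q01; set S := \sum_(i < m) _.
have exp01 k : 0 <= q ^+ k <= 1 by rewrite exprn_ge0 ?exprn_ile1.
suff : 0 <= S *+ 2 by rewrite pmulrn_lge0.
rewrite mulr2n {1}/S (reindex_inj rev_ord_inj) -big_split /=.
apply: sumr_ge0 => i _; have lt_im := ltn_ord i.
(* With a = q^(m-1-i) and b = q^i one has q^m = a b q and q^(2m-1) = (a b)^2 q, which is the form of
   [paired_terms_ge0]. *)
have -> : q ^+ (m.*2).-1 = (q ^+ (m - i.+1) * q ^+ i) ^+ 2 * q.
  by rewrite -exprD -exprM -exprSr; congr (q ^+ _); lia.
have -> : q ^+ m = q ^+ (m - i.+1) * q ^+ i * q.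
  by rewrite -exprD -exprSr; congr (q ^+ _); lia.
have := paired_terms_ge0 (exp01 (m - i.+1)%N) (exp01 i) q01.
by congr (0 <= _); ring.
Qed.

Lemma one_subX (q : C) m : 1 - q ^+ m = (1 - q) * \sum_(i < m) q ^+ i.
Proof. by rewrite -opprB subrX1 -mulNr opprB. Qed.

(** On the left is the probability of at least two hits among 2m trials, on the right twice that of
    a hit in each half. *)
Lemma two_hits_le_mixed q m : 0 <= q <= 1 ->
  1 - q ^+ m.*2 - (m.*2)%:R * (1 - q) * q ^+ (m.*2).-1 <= 2 * (1 - q ^+ m) ^+ 2.
Proof.
move=> q01; have [_ q1] := andP q01; rewrite -subr_ge0.
(* With Q = q^m, the part without the linear term is 1 - 4 Q + 3 Q^2 = (1 - Q) (1 - 3 Q), and 1 - q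
   divides 1 - Q. *)
have -> : 2 * (1 - q ^+ m) ^+ 2 - (1 - q ^+ m.*2 - (m.*2)%:R * (1 - q) * q ^+ (m.*2).-1)
    = (1 - q) * \sum_(i < m) (q ^+ i * (1 - 3 * q ^+ m) + 2 * q ^+ (m.*2).-1).
  rewrite big_split /= -mulr_suml sumr_const card_ord [RHS]mulrDr [X in _ = X + _]mulrA -one_subX.
  by rewrite -addnn exprD natrD -[_ *+ m]mulr_natl; ring.
by rewrite mulr_ge0 ?subr_ge0 ?geometric_sum_ge0.
Qed.

(** Each of the m terms of the geometric sum for (1 - q^m) / (1 - q) is at least q^(m-1). *)
Lemma natr_mul_geometric_le1 q m : 0 <= q <= 1 -> m%:R * (1 - q) * q ^+ m.-1 <= 1.
Proof.
case/andP=> q0 q1; apply: (@le_trans _ _ (1 - q ^+ m)); last first.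
  by rewrite lerBlDr lerDl exprn_ge0.
rewrite one_subX mulrAC mulrC ler_wpM2l ?subr_ge0 // mulr_natl -[m in _ *+ m]card_ord.
rewrite -sumr_const ler_sum // => i _; rewrite ler_wiXn2l //.
by have := ltn_ord i; lia.
Qed.

End Inequalities.

(** * The probability bound and its limit *)

Lemma pboolP (P : Prop) : reflect P (pbool P).
Proof. by rewrite /pbool; case: ClassicalEpsilon.excluded_middle_informative; constructor. Qed.

Lemma bound_le_prob_obs (C : numClosedFieldType) (p : C) m n (l0 : 'I_n)
    (E : {set 'I_m.*2 * 'I_n} -> Prop) : 0 <= p <= 1 ->
  (forall (Om : {set 'I_m.*2 * 'I_n}) a b, (a, l0) \in Om -> (b, l0) \in Om ->
     odd a != odd b -> E Om) ->
  bound m.*2 p <= prob_obs p E.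
Proof.
move=> /andP[p0 p1] mixedE.
(* The positions of column [l0] in rows of parity b; [E] holds as soon as both classes are hit. *)
pose A b := setX [set i : 'I_m.*2 | odd i == b] [set l0].
have cardA b : #|A b| = m by rewrite cardsX card_odd_ord cards1 muln1.
have disjA : [disjoint A true & A false].
  rewrite -setI_eq0; apply/eqP/setP=> -[i l]; rewrite !inE /=.
  by case: (odd i); rewrite ?andbF.
apply: (@le_trans _ _ ((1 - (1 - p) ^+ m) ^+ 2)).
  have := @two_hits_le_mixed _ (1 - p) m; rewrite subr_ge0 p1 lerBlDr lerDl p0.
  by rewrite opprB addrCA subrr addr0 /bound => /(_ isT); rewrite -ler_pdivrMl.
rewrite -(sum_hitting_both p disjA (cardA _) (cardA _)) card_prod !card_ord.
rewrite /prob_obs big_mkcond [leRHS]big_mkcond; apply: ler_sum => Om _.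
have w_ge0 : 0 <= p ^+ #|Om| * (1 - p) ^+ (m.*2 * n - #|Om|).
  by rewrite mulr_ge0 ?exprn_ge0 ?subr_ge0.
case: pboolP => [_|notE]; first by case: ifP.
case: ifP => // /andP[/set0Pn[[a l]] + /set0Pn[[b l']]]; rewrite !inE /=.
move=> /and3P[Om_a /eqP odd_a /eqP def_l] /and3P[Om_b /eqP odd_b /eqP def_l'].
by case: notE; apply: (mixedE Om a b); rewrite -?def_l -?def_l' ?odd_a ?odd_b // def_l -def_l'.
Qed.

Lemma bound_cvg (C : archiClosedFieldType) (p eps : C) : 0 < p -> p <= 1 -> 0 < eps ->
  exists L0 : nat, forall L : nat, (L0 <= L)%N -> `|bound (2 ^ L) p - 2^-1| < eps.
Proof.
(* With d = 2m, the deviation from 1/2 is at most 2 q^(m-1) <= 2 / (m p), so m > 2 / (p eps)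
   suffices. The successor accounts for m = d / 2, and 2^L > L does the rest. *)
move=> p_gt0 p_le1 eps_gt0; exists (Num.bound (2 / (p * eps))).+1 => -[//|L] /ltnSE leL.
set q := 1 - p; have q01 : 0 <= q <= 1 by rewrite subr_ge0 p_le1 lerBlDr lerDl ltW.
have [q0 q1] := andP q01; set m := (2 ^ L)%N.
have m_gt0 : (0 < m)%N by rewrite expn_gt0.
have -> : (2 ^ L.+1 = m.*2)%N by rewrite expnS mul2n.
have mpq : m%:R * p * q ^+ m.-1 <= 1.
  by have := natr_mul_geometric_le1 m q01; rewrite /q opprB addrCA subrr addr0.
have -> : bound m.*2 p - 2^-1 =
    - (2^-1 * (q ^+ m * q ^+ m + 2 * (m%:R * p * q ^+ m.-1 * q ^+ m))).
  rewrite /bound -/q -addnn natrD; have -> : (m + m).-1 = (m.-1 + m)%N by lia.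
  by rewrite !exprD; field.
have qm_le : q ^+ m <= q ^+ m.-1 by rewrite ler_wiXn2l // leq_pred.
have le_half : 2^-1 * (q ^+ m * q ^+ m + 2 * (m%:R * p * q ^+ m.-1 * q ^+ m)) <=
    2 * q ^+ m.-1.
  rewrite ler_pdivrMl //; apply: (@le_trans _ _ (1 * q ^+ m.-1 + 2 * (1 * q ^+ m.-1))).
    rewrite lerD //; first by rewrite ler_pM ?exprn_ge0 ?exprn_ile1.
    by rewrite ler_wpM2l // ler_pM ?exprn_ge0 ?mulr_ge0 ?exprn_ge0 // ltW.
  rewrite -subr_ge0; suff: 0 <= q ^+ m.-1 by congr (0 <= _); ring.
  exact: exprn_ge0.
rewrite normrN ger0_norm; last first.
  by rewrite mulr_ge0 ?invr_ge0 // addr_ge0 // !mulr_ge0 ?exprn_ge0 // ltW.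
apply: le_lt_trans le_half _.
have mp_gt0 : 0 < m%:R * p by rewrite mulr_gt0 ?ltr0n.
rewrite -(ltr_pM2l mp_gt0) mulrCA (@le_lt_trans _ _ 2) //.
  by rewrite -[leRHS]mulr1 ler_wpM2l.
rewrite -mulrA -ltr_pdivrMr ?mulr_gt0 //.
apply: lt_le_trans (archi_boundP _) _; first by rewrite divr_ge0 // ltW // mulr_gt0.
by rewrite ler_nat (leq_trans leL) // ltnW // ltn_expl.
Qed.

End Probability.

Theorem theorem1 (C : archiClosedFieldType) (p : C)
    (p_real : p \is Num.real) (p_gt0 : 0 < p) (p_le1 : p <= 1) :
  (forall (L n n1 n2 : nat), (0 < L)%N -> (0 < n)%N -> (0 < n1)%N -> (0 < n2)%N ->
     (n1 + n2 = n + 1)%N ->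
     bound (2 ^ L) p <= @prob_obs C (2 ^ L) n p (@unique_solution C (2 ^ L) n n1 n2))
  /\
  (forall eps : C, 0 < eps -> exists L0 : nat, forall L : nat, (L0 <= L)%N ->
     `|bound (2 ^ L) p - 2^-1| < eps).
Proof.
split=> [L n n1 n2 L_gt0 n_gt0 n1_gt0 n2_gt0 def_n | eps]; last exact: bound_cvg.
have def_d : (2 ^ L = (2 ^ L.-1).*2)%N by rewrite -mul2n -expnS prednK.
(* Put into the goal first, so that the rewriting of 2^L as a double also reaches the types in
   it. *)
have mixed := @unique_solution_mixed_parity C L n n1 n2.
move: mixed; rewrite def_d => mixed.
apply: (@bound_le_prob_obs _ _ _ _ (Ordinal n_gt0)) => [|Om a b Om_a Om_b neq_ab].
  by rewrite ltW.
exact: mixed Om_a Om_b neq_ab.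
Qed.
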